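(* Suppose $(X,\mathcal{A},\mu)$ is a Peano-Jordan complete charge space with null sets $\mathcal{N}$, and $\mathcal{A}^{\prime}$ is a sub-field of $\mathcal{A}$ such that $\overline{\alpha(\mathcal{A}^{\prime} \cup \mathcal{N})} = \alpha(\overline{\mathcal{A}^{\prime}} \cup \mathcal{N})$. Given a chain $\mathcal{T} \subseteq \overline{\alpha(\mathcal{A}^{\prime} \cup \mathcal{N})}$ (a family of sets totally ordered by inclusion), there exists a map $\phi : \mathcal{T} \rightarrow \overline{\mathcal{A}^{\prime}}$ such that: 1. for all $A \in \mathcal{T}$, $\phi(A) \triangle A \in \mathcal{N}$; 2. for all $A, B \in \mathcal{T}$, \[ [A]_{\mathcal{A} / \mathcal{N}} = [B]_{\mathcal{A} / \mathcal{N}} \iff \phi(A) = \phi(B), \quad\text{and}\quad [A]_{\mathcal{A} / \mathcal{N}} < [B]_{\mathcal{A} / \mathcal{N}} \iff \phi(A) \subsetneq \phi(B). \]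
   Context: A field of subsets of a set $X$ is a collection containing $\emptyset$ and closed under complements and finite unions. A charge $\mu$ on a field $\mathcal{A}$ is a function $\mu:\mathcal{A}\to[0,\infty)$ with $\mu(\emptyset)=0$ and $\mu(A\cup B)=\mu(A)+\mu(B)$ for disjoint $A,B\in\mathcal{A}$ (all charges are non-negative and bounded). $(X,\mathcal{A},\mu)$ is then a charge space. For a sub-field $\mathcal{B}\subseteq\mathcal{A}$, the charge on $\mathcal{B}$ is the restriction of $\mu$, and its Peano-Jordan completion is the field $\overline{\mathcal{B}}:=\{A\subseteq X:\forall\epsilon>0\ \exists B,C\in\mathcal{B}, B\subseteq A\subseteq C, \mu(C\setminus B)<\epsilon\}$. $(X,\mathcal{A},\mu)$ is Peano-Jordan complete if $\overline{\mathcal{A}}=\mathcal{A}$. The null sets are $\mathcal{N}:=\{A\subseteq X:\mu^*(A)=0\}$, where $\mu^*(A):=\inf\{\mu(B):B\in\mathcal{A},A\subseteq B\}$; Peano-Jordan completeness gives $\mathcal{N}\subseteq\mathcal{A}$. $\alpha(\mathcal{C})$ is the smallest field of subsets of $X$ containing $\mathcal{C}$. $[A]_{\mathcal{A}/\mathcal{N}}$ is the class of $A\in\mathcal{A}$ in the quotient Boolean algebra $\mathcal{A}/\mathcal{N}$ ($A\sim B\iff A\triangle B\in\mathcal{N}$), with order $[A]\le[B]\iff A\setminus B\in\mathcal{N}$, and $[A]<[B]$ meaning $[A]\le[B]$ and $[A]\ne[B]$. *)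

(* Defs.v *)
From mathcomp Require Import all_boot all_order all_algebra.
From mathcomp Require Import boolp classical_sets functions reals.
From mathcomp Require Import measurable_structure.
From mathcomp Require Import lra.

Set Implicit Arguments.
Unset Strict Implicit.
Unset Printing Implicit Defensive.

Import Order.TTheory GRing.Theory Num.Theory.
Local Open Scope classical_set_scope.
Local Open Scope ring_scope.

Section Charges.
Context {R : realType} {X : Type}.
Implicit Types (F G : set (set X)) (mu : set X -> R) (A B C : set X).

Definition set_field F := [/\ F set0, setC_closed F & setU_closed F].

Definition generated_field G : set (set X) := smallest set_field G.

(* A charge on [F] is given by a function on all subsets of [X] whose values
   outside [F] are irrelevant; non-negative, unlike the signed charges of the
   library. Being real-valued, it is bounded by its value at [setT]. *)
Definition field_charge F mu :=
  [/\ mu set0 = 0,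
      (forall A, F A -> 0 <= mu A) &
      (forall A B, F A -> F B -> A `&` B = set0 ->
         mu (A `|` B) = mu A + mu B)].

Definition charge_space F mu := set_field F /\ field_charge F mu.

Definition pj_completion F mu : set (set X) :=
  [set A | forall eps : R, 0 < eps ->
     exists B C, [/\ F B, F C, B `<=` A, A `<=` C & mu (C `\` B) < eps]].

Definition pj_complete F mu := pj_completion F mu = F.

Definition outer_charge F mu A : R :=
  inf [set mu B | B in [set B | F B /\ A `<=` B]].

Definition null_sets F mu : set (set X) := [set A | outer_charge F mu A = 0].

(* An element of the quotient Boolean algebra of [F] by the null sets is
   represented as an equivalence class, i.e. a set of members of [F]. *)
Definition null_class F mu A : set (set X) :=
  [set B | F B /\ null_sets F mu (A `+` B)].

(* The order of the quotient, read on representatives; see [null_class_leP]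
   for the independence of their choice. *)
Definition null_class_le F mu (a b : set (set X)) :=
  exists A B, [/\ a A, b B & null_sets F mu (A `\` B)].

Definition null_class_lt F mu (a b : set (set X)) :=
  null_class_le F mu a b /\ a <> b.

Lemma set_fieldT F : set_field F -> F setT.
Proof. by case=> F0 FC _; rewrite -setC0; exact: FC. Qed.

Lemma set_fieldD F A B : set_field F -> F A -> F B -> F (A `\` B).
Proof.
case=> F0 FC FU FA FB.
by rewrite setDE -(setCK A) -setCU; apply: (FC); apply: FU => //; exact: FC.
Qed.

Lemma field_charge_le F mu A B : charge_space F mu ->
  F A -> F B -> A `<=` B -> mu A <= mu B.
Proof.
move=> [Ff [_ mu_ge0 muD]] FA FB AB.
have FD := set_fieldD Ff FB FA.
by rewrite -(setDUK AB) muD ?setDIK // lerDl mu_ge0.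
Qed.

Lemma field_chargeU_le F mu A B : charge_space F mu ->
  F A -> F B -> mu (A `|` B) <= mu A + mu B.
Proof.
move=> Fmu FA FB; have [Ff [_ _ muD]] := Fmu.
have FD := set_fieldD Ff FB FA.
have -> : A `|` B = A `|` (B `\` A).
  by apply/seteqP; split=> x /=; case: (pselect (A x)); tauto.
rewrite muD ?setDIK // lerD2l.
by apply: (field_charge_le Fmu) => // x [].
Qed.

Lemma null_setsP F mu A : charge_space F mu ->
  null_sets F mu A <->
  forall eps : R, 0 < eps -> exists B, [/\ F B, A `<=` B & mu B < eps].
Proof.
move=> [Ff [_ mu_ge0 _]]; rewrite /null_sets /outer_charge /=.
set E := (X in inf X).
have E0 : E !=set0.
  by exists (mu setT), setT => //; split => //; exact: set_fieldT.
have E_ge0 : lbound E 0 by move=> _ [B [FB _] <-]; exact: mu_ge0.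
split=> [infE eps eps_gt0|null].
  have [|_ [B [FB AB] <-] muB] := @inf_lt _ E eps E0; first by rewrite infE.
  by exists B.
apply/eqP; rewrite eq_le lb_le_inf // andbT leNgt; apply/negP => inf_gt0.
have [B [FB AB]] := null _ inf_gt0; apply/negP; rewrite -leNgt.
by apply: ge_inf; [exists 0 | exists B].
Qed.

Lemma null_sets_sub F mu A B : charge_space F mu ->
  A `<=` B -> null_sets F mu B -> null_sets F mu A.
Proof.
move=> Fmu AB /(null_setsP _ Fmu) nB; apply/(null_setsP _ Fmu) => eps.
by move=> /nB[C [FC BC muC]]; exists C; split=> // x /AB /BC.
Qed.

Lemma null_setsU F mu A B : charge_space F mu ->
  null_sets F mu A -> null_sets F mu B -> null_sets F mu (A `|` B).
Proof.
move=> Fmu /(null_setsP _ Fmu) nA /(null_setsP _ Fmu) nB.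
apply/(null_setsP _ Fmu) => eps eps_gt0.
have [|C [FC AC muC]] := nA (eps / 2); first by lra.
have [|D [FD BD muD]] := nB (eps / 2); first by lra.
exists (C `|` D); split; first by case: Fmu => -[_ _ FU] _; exact: FU.
- by move=> x [/AC|/BD]; [left|right].
- have := field_chargeU_le Fmu FC FD; lra.
Qed.

Lemma null_class_refl F mu A : charge_space F mu -> F A -> null_class F mu A A.
Proof.
move=> Fmu FA; split => //; rewrite setYK; apply/(null_setsP _ Fmu) => eps.
by case: Fmu => -[F0 _ _] [mu0 _ _] eps_gt0; exists set0; rewrite mu0; split.
Qed.

Lemma null_class_eqP F mu A B : charge_space F mu -> F A -> F B ->
  null_class F mu A = null_class F mu B <-> null_sets F mu (A `+` B).
Proof.
move=> Fmu FA FB; split=> [eAB|nAB].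
  by have := null_class_refl Fmu FB; rewrite -eAB => -[].
apply/seteqP; split=> C [FC nC]; split=> //;
  apply: null_sets_sub (null_setsU Fmu nAB nC) => // x /=;
  case: (pselect (A x)); case: (pselect (B x)); tauto.
Qed.

Lemma null_class_leP F mu A B : charge_space F mu -> F A -> F B ->
  null_class_le F mu (null_class F mu A) (null_class F mu B) <->
  null_sets F mu (A `\` B).
Proof.
move=> Fmu FA FB; split=> [[A' [B' [[_ nA] [_ nB] nAB]]]|nAB].
  apply: null_sets_sub (null_setsU Fmu nA (null_setsU Fmu nB nAB)) => // x /=.
  case: (pselect (A' x)); case: (pselect (B' x)); tauto.
by exists A, B; split => //; exact: null_class_refl.
Qed.

End Charges.

(* Main.v *)
Require Import Defs.
From mathcomp Require Import all_boot all_order all_algebra.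
From mathcomp Require Import boolp classical_sets functions cardinality reals.
From mathcomp Require Import measurable_structure.
From mathcomp Require Import lra.

Set Implicit Arguments.
Unset Strict Implicit.
Unset Printing Implicit Defensive.

Import Order.TTheory GRing.Theory Num.Theory.
Local Open Scope classical_set_scope.
Local Open Scope ring_scope.

(** On a chain, the class of a set modulo null sets is determined by its charge,
    so the chain of classes is order-isomorphic to a set of reals and has a
    countable subfamily [a] approximating every member from both sides. Choose
    [b i] in the completion of [F'] null-equivalent to [a i], let [E i] be the
    null set of points at which [b 0], ..., [b i] fail to be monotone, and put
    [phi A] := the union of the [b i `\` E i] such that [mu (a i) <= mu A].
    It is monotone in [mu A]. At [A = a n] the union is finite, since points
    outside [E n] contribute only to [b n] and points of [E n] only matter for
    [i < n]; a general [phi A] is squeezed between values at members of [a]. *)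

(** * Countable two-sided approximation of real values *)

Lemma two_sided_dense_sequence (R : realType) (I : Type) (S : set I)
    (f : I -> R) : S !=set0 ->
  exists2 a : nat -> I, (forall n, S (a n)) &
    forall s (eps : R), S s -> 0 < eps -> exists m n,
      [/\ f s - eps < f (a m), f (a m) <= f s, f s <= f (a n) &
          f (a n) < f s + eps].
Proof.
move=> [s0 Ss0].
(* A key is a rational interval with a flag. Besides picking a member of each nonempty [J k], [g]
   picks one minimising [f] (flag [true]) or maximising it (flag [false]) when the extremum is
   attained. This catches values isolated on one side, which an arbitrary pick in each interval
   could miss. *)
pose J (k : rat * rat * bool) :=
  [set s | [/\ S s, ratr k.1.1 < f s & f s < ratr k.1.2]].
pose ext (b : bool) (x y : R) := if b then x <= y else y <= x.
have /choice[g gP] : forall k, exists s, S s /\ (J k !=set0 -> J k s /\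
    ((exists2 t, J k t & forall u, J k u -> ext k.2 (f t) (f u)) ->
     forall u, J k u -> ext k.2 (f s) (f u))).
  move=> k; have [[t Jt tP]|noext] :=
    pselect (exists2 t, J k t & forall u, J k u -> ext k.2 (f t) (f u)).
    by exists t; split; [case: Jt|].
  have [[t Jt]|empty] := pselect (J k !=set0); last by exists s0.
  by exists t; split; [case: Jt|].
(* Any default key would do for numbers that code none, as [g] always lands in [S]. *)
exists (fun n => g (odflt (0, 0, true) (unpickle n))).
  by move=> n; have [] := gP (odflt (0, 0, true) (unpickle n)).
move=> s eps Ss eps0.
have [p /andP[p1 p2]] : exists p : rat, f s - eps < ratr p < f s.
  by have [|p] := @rat_in_itvoo R (f s - eps) (f s); [lra|exists p].
have [q /andP[q1 q2]] : exists q : rat, f s < ratr q < f s + eps.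
  by have [|q] := @rat_in_itvoo R (f s) (f s + eps); [lra|exists q].
have [k1 [k11 k12]] : exists k, f s - eps < f (g k) /\ f (g k) <= f s.
  (* If some value lies strictly between [p] and [f s], an interval ending at a rational [q'] below
     [f s] is nonempty. Otherwise [s] itself attains the minimum over the interval from [p] to
     [q]. *)
  have [[t [St pt ts]]|nt] :=
    pselect (exists t, [/\ S t, ratr p < f t & f t < f s]).
    have [q' /andP[tq' q's]] : exists q : rat, f t < ratr q < f s.
      by have [|q'] := @rat_in_itvoo R (f t) (f s); [lra|exists q'].
    exists (p, q', true); have [_] := gP (p, q', true).
    by case; [exists t|move=> [/= _ ? ?] _; lra].
  exists (p, q, true); have [_] := gP (p, q, true).
  case; [by exists s|move=> [/= _ h1 h2] h3].
  split; [lra|apply: h3; last by split].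
  exists s; first by split.
  move=> u [/= Su pu uq]; rewrite /ext leNgt; apply/negP => us.
  by apply: nt; exists u.
have [k2 [k21 k22]] : exists k, f s <= f (g k) /\ f (g k) < f s + eps.
  have [[t [St pt ts]]|nt] :=
    pselect (exists t, [/\ S t, f s < f t & f t < ratr q]).
    have [q' /andP[tq' q's]] : exists q : rat, f s < ratr q < f t.
      by have [|q'] := @rat_in_itvoo R (f s) (f t); [lra|exists q'].
    exists (q', q, false); have [_] := gP (q', q, false).
    by case; [exists t|move=> [/= _ ? ?] _; lra].
  exists (p, q, false); have [_] := gP (p, q, false).
  case; [by exists s|move=> [/= _ h1 h2] h3].
  split; [apply: h3; last by split|lra].
  exists s; first by split.
  move=> u [/= Su pu uq]; rewrite /ext leNgt; apply/negP => us.
  by apply: nt; exists u.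
by exists (pickle k1), (pickle k2); rewrite !pickleK.
Qed.

(** * Fields, null sets and Peano-Jordan completions *)

Section Fields.
Context {R : realType} {X : Type}.
Implicit Types (F G : set (set X)) (mu : set X -> R) (A B C : set X).

Lemma set_fieldI F A B : set_field F -> F A -> F B -> F (A `&` B).
Proof.
move=> Ff FA FB; rewrite -setDD.
by apply: (set_fieldD Ff) => //; apply: set_fieldD.
Qed.

Lemma set_fieldY F A B : set_field F -> F A -> F B -> F (A `+` B).
Proof.
move=> Ff FA FB; have [_ _ FU] := Ff.
by apply: FU; apply: set_fieldD.
Qed.

Lemma charge_space_sub F G mu :
  charge_space F mu -> set_field G -> G `<=` F -> charge_space G mu.
Proof.
move=> [_ [mu0 mu_ge0 muD]] Gf GF; split=> //; split=> //.
  by move=> A /GF; exact: mu_ge0.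
by move=> A B /GF FA /GF FB; exact: muD.
Qed.

Lemma field_chargeDI F mu A B : charge_space F mu -> F A -> F B ->
  mu A = mu (A `&` B) + mu (A `\` B).
Proof.
move=> [Ff [_ _ muD]] FA FB; rewrite -muD.
- by rewrite setUIDK.
- exact: set_fieldI.
- exact: set_fieldD.
- by apply/seteqP; split=> x //= [[_ ?] []].
Qed.

Lemma null_sets_charge0 F mu A : charge_space F mu -> F A ->
  null_sets F mu A <-> mu A = 0.
Proof.
move=> Fmu FA; rewrite (null_setsP _ Fmu); split=> [nA|A0 eps eps0].
  apply/eqP; rewrite eq_le; case: (Fmu) => _ [_ -> // _]; rewrite andbT.
  apply/ler_addgt0Pl => eps /nA[B [FB AB muB]].
  by rewrite addr0 (le_trans (field_charge_le Fmu FA FB AB))// ltW.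
by exists A; rewrite A0; split.
Qed.

Lemma pj_completion_le F G mu :
  F `<=` G -> pj_completion F mu `<=` pj_completion G mu.
Proof.
move=> FG A FA eps /FA[B [C [FB FC BA AC muCB]]].
by exists B, C; split=> //; exact: FG.
Qed.

Lemma sub_pj_completion F mu : charge_space F mu -> F `<=` pj_completion F mu.
Proof. by move=> [_ [mu0 _ _]] A FA eps eps0; exists A, A; rewrite setDv mu0; split. Qed.

Lemma pj_completion_field F mu :
  charge_space F mu -> set_field (pj_completion F mu).
Proof.
move=> Fmu; have [Ff _] := Fmu; have [F0 FC FU] := Ff; split.
- exact: sub_pj_completion.
- move=> A FA eps /FA[B [C [FB FC' BA AC muCB]]].
  exists (~` C), (~` B); split; [exact: FC|exact: FC| | |].
  + exact: subsetC.
  + exact: subsetC.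
  + by rewrite setDE setCK setIC -setDE.
- move=> A1 A2 FA1 FA2 eps eps0.
  have [|B1 [C1 [FB1 FC1 BA1 AC1 mu1]]] := FA1 (eps / 2); first by lra.
  have [|B2 [C2 [FB2 FC2 BA2 AC2 mu2]]] := FA2 (eps / 2); first by lra.
  exists (B1 `|` B2), (C1 `|` C2); split; [exact: FU|exact: FU| | |].
  + exact: setUSS.
  + exact: setUSS.
  + have FD1 := set_fieldD Ff FC1 FB1; have FD2 := set_fieldD Ff FC2 FB2.
    have FD : F ((C1 `|` C2) `\` (B1 `|` B2)).
      by apply: set_fieldD => //; exact: FU.
    have := field_chargeU_le Fmu FD1 FD2.
    suff /(field_charge_le Fmu FD (FU _ _ FD1 FD2)) : (C1 `|` C2) `\` (B1 `|` B2)
      `<=` (C1 `\` B1) `|` (C2 `\` B2) by lra.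
    by move=> x /=; tauto.
Qed.

(** The gap between [B1] and [C2] is covered by one gap from each of three approximations, hence
    [eps / 3]. The inclusions in [F] keep the estimates where [mu] is a charge. *)
Lemma pj_completion_idem F G mu : charge_space F mu -> set_field G ->
  G `<=` F -> pj_completion G mu `<=` F ->
  pj_completion (pj_completion G mu) mu `<=` pj_completion G mu.
Proof.
move=> Fmu Gf GF GcF A AA eps eps0.
have [|B [C [GB GC BA AC muCB]]] := AA (eps / 3); first by lra.
have [|B1 [B2 [GB1 GB2 B1B BB2 mu1]]] := GB (eps / 3); first by lra.
have [|C1 [C2 [GC1 GC2 C1C CC2 mu2]]] := GC (eps / 3); first by lra.
exists B1, C2; split=> //; first exact: subset_trans BA.
  exact: subset_trans CC2.
have [Ff _] := Fmu; have [_ _ FU] := Ff.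
have FD1 := set_fieldD Ff (GF _ GB2) (GF _ GB1).
have FD2 := set_fieldD Ff (GF _ GC2) (GF _ GC1).
have FD3 := set_fieldD Ff (GcF _ GC) (GcF _ GB).
have := field_chargeU_le Fmu FD1 FD2.
have := field_chargeU_le Fmu (FU _ _ FD1 FD2) FD3.
have FD := set_fieldD Ff (GF _ GC2) (GF _ GB1).
suff /(field_charge_le Fmu FD (FU _ _ (FU _ _ FD1 FD2) FD3)) : C2 `\` B1 `<=`
  ((B2 `\` B1) `|` (C2 `\` C1)) `|` (C `\` B) by lra.
move=> x /= [C2x B1x]; move: (C1C x) (BB2 x).
by case: (pselect (B x)); case: (pselect (C1 x)); tauto.
Qed.

Lemma pj_complete_null_sets F mu : charge_space F mu -> pj_complete F mu ->
  null_sets F mu `<=` F.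
Proof.
move=> Fmu Fc A /(null_setsP _ Fmu) nA; rewrite -Fc => eps /nA[B [FB AB muB]].
by exists set0, B; rewrite setD0; split=> //; case: Fmu => -[].
Qed.

Lemma null_sets0 F mu : charge_space F mu -> null_sets F mu set0.
Proof.
by move=> Fmu; have [[F0 _ _] [mu0 _ _]] := Fmu; apply/null_sets_charge0.
Qed.

(** The sets agreeing with a member of [G] up to a null set form a field that contains [G] and all
    null sets. *)
Lemma generated_field_null_rep F G mu A : charge_space F mu -> set_field G ->
  generated_field (G `|` null_sets F mu) A ->
  exists2 B, G B & null_sets F mu (B `+` A).
Proof.
move=> Fmu Gf; have [G0 GC GU] := Gf.
apply: (smallest_sub (X := [set A | exists2 B, G B & null_sets F mu (B `+` A)])).
  split=> /=.
  - by exists set0 => //; rewrite setYK; exact: null_sets0.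
  - move=> C [B GB nBC]; exists (~` B); first exact: GC.
    apply: null_sets_sub nBC => // x /=.
    by case: (pselect (B x)); case: (pselect (C x)); tauto.
  - move=> C C' [B GB nBC] [B' GB' nBC']; exists (B `|` B'); first exact: GU.
    apply: null_sets_sub (null_setsU Fmu nBC nBC') => // x /=.
    case: (pselect (B x)); case: (pselect (C x)); tauto.
move=> C [GC'|nC] /=; first by exists C => //; rewrite setYK; exact: null_sets0.
by exists set0 => //; apply: null_sets_sub nC => // x /=; tauto.
Qed.

(** With [Num.max], the charge of a difference depends only on the two charges, whichever inclusion
    holds. *)
Lemma comparable_chargeD F mu A B : charge_space F mu -> F A -> F B ->
  A `<=` B \/ B `<=` A -> mu (A `\` B) = Num.max 0 (mu A - mu B).
Proof.
move=> Fmu FA FB; have [_ [mu0 mu_ge0 _]] := Fmu.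
case=> AB.
  have -> : A `\` B = set0 by apply/seteqP; split=> x //= [/AB].
  by rewrite mu0 max_l// subr_le0 (field_charge_le Fmu).
rewrite max_r; last by rewrite subr_ge0 (field_charge_le Fmu).
rewrite (field_chargeDI Fmu FA FB) (_ : A `&` B = B); first by lra.
exact/setIidPr.
Qed.

End Fields.

(** * Correcting a sequence of sets to respect a relation on indices *)

Section Rectification.
Context {X : Type} (r : nat -> nat -> Prop) (b : nat -> set X).

Definition disorder n : set X :=
  [set x | exists i j, [/\ (i <= n)%N, (j <= n)%N, r i j & (b i `\` b j) x]].

Lemma disorder_le m n : (m <= n)%N -> disorder m `<=` disorder n.
Proof.
by move=> mn x [i [j [im jm rij bx]]]; exists i, j; split=> //; exact: leq_trans mn.
Qed.

Definition rectified (P : nat -> Prop) : set X :=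
  \bigcup_(i in P) (b i `\` disorder i).

Lemma rectifiedE n : r n n -> rectified (r^~ n) =
  \bigcup_(i in [set i | (i < n.+1)%N /\ r i n]) (b i `\` disorder i).
Proof.
move=> rnn; apply/seteqP; split=> x; last by move=> [i [_ ri] bx]; exists i.
move=> [i rin bx].
(* A term with [i > n] adds nothing: its points avoid [disorder i], hence also the smaller
   [disorder n], and [r i n] forces them into [b n], so term [n] has them already. *)
have [iln|nli] := leqP i n; first by exists i.
exists n => //=; move: bx => [bix nEx].
have nEnx : ~ disorder n x by move=> /(disorder_le (ltnW nli)).
split=> //; apply: contrapT => nbn; apply: nEx.
by exists i, n; split=> //; exact: ltnW.
Qed.

(** Off [disorder n], the terms kept by [rectifiedE] lie in [b n] because [r i n], and all of [b n]
    survives in term [n]. *)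
Lemma rectified_sub n : r n n -> rectified (r^~ n) `+` b n `<=` disorder n.
Proof.
move=> rnn x; have [//|nE] := pselect (disorder n x); case.
  rewrite (rectifiedE rnn) => -[[i [iln rin] [bix nEx]] nbx].
  by exists i, n.
by move=> [bnx] []; exists n.
Qed.

(** Only finite unions of differences over related pairs occur, so [F] may be the ideal of null sets
    as well as a field. *)
Lemma disorder_closed (F : set (set X)) n : F set0 -> setU_closed F ->
  (forall i j, r i j -> F (b i `\` b j)) -> F (disorder n).
Proof.
move=> F0 FU Fr; have Fcup : fin_bigcup_closed F by apply/fin_bigcup_closedP.
rewrite (_ : disorder n =
  \bigcup_(i in [set i | (i < n.+1)%N /\ True])
    \bigcup_(j in [set j | (j < n.+1)%N /\ r i j]) (b i `\` b j)).
  apply: (Fcup) => [|i _]; first by apply: sub_finite_set (finite_II n.+1) => i [].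
  apply: Fcup => [|j [_ rij]]; last exact: Fr.
  by apply: sub_finite_set (finite_II n.+1) => j [].
apply/seteqP; split=> x.
  by move=> [i [j [? ? ? ?]]]; exists i => //; exists j.
by move=> [i [? _] [j [? ?] ?]]; exists i, j.
Qed.

(** The defining union may be infinite while a field has only finite ones; [rectifiedE] removes the
    tail. *)
Lemma rectified_field (F : set (set X)) n : set_field F ->
  (forall i, F (b i)) -> r n n -> F (rectified (r^~ n)).
Proof.
move=> Ff Fb rnn; have [F0 FC FU] := Ff; rewrite (rectifiedE rnn).
have Fcup : fin_bigcup_closed F by apply/fin_bigcup_closedP.
apply: Fcup => [|i _]; first by apply: sub_finite_set (finite_II n.+1) => i [].
apply: set_fieldD => //.
by apply: disorder_closed => // j k _; exact: set_fieldD.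
Qed.

End Rectification.

(** * Order-preserving representatives of a chain *)

Theorem lemma33 (R : realType) (X : Type) (F F' : set (set X))
    (mu : set X -> R) (T : set (set X)) :
  charge_space F mu ->
  pj_complete F mu ->
  set_field F' ->
  F' `<=` F ->
  pj_completion (generated_field (F' `|` null_sets F mu)) mu =
    generated_field (pj_completion F' mu `|` null_sets F mu) ->
  T `<=` pj_completion (generated_field (F' `|` null_sets F mu)) mu ->
  total_on T subset ->
  exists phi : set X -> set X,
    [/\ set_fun T (pj_completion F' mu) phi,
        (forall A, T A -> null_sets F mu (phi A `+` A)) &
        (forall A B, T A -> T B ->
           (null_class F mu A = null_class F mu B <-> phi A = phi B) /\
           (null_class_lt F mu (null_class F mu A) (null_class F mu B) <->
              phi A `<` phi B))].
Proof.
move=> Fmu Fc F'f F'F eqG Tg Tch.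
have F'mu := charge_space_sub Fmu F'f F'F.
have Bf := pj_completion_field F'mu.
have BF : pj_completion F' mu `<=` F by rewrite -Fc; exact: pj_completion_le.
have NF := pj_complete_null_sets Fmu Fc.
have [Ff _] := Fmu; have [_ _ FU] := Ff.
have N0 := null_sets0 Fmu.
have NU := fun A B => @null_setsU _ _ F mu A B Fmu.
(* The equality of the two fields enters here, giving representatives in the completion of [F'];
   they need not yet respect inclusion. Off [T] the value [set0] is a dummy. *)
have /choice[c cP] : forall A, exists C, T A ->
    pj_completion F' mu C /\ null_sets F mu (C `+` A).
  move=> A; have [/Tg|nTA] := pselect (T A); last by exists set0.
  by rewrite eqG => /(generated_field_null_rep Fmu Bf)[C BC nC]; exists C.
have TF : T `<=` F.
  move=> A /cP[Bc nc].
  have -> : A = c A `+` (c A `+` A) by rewrite setYA setYK set0Y.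
  by apply: set_fieldY => //; [exact: BF|exact: NF].
have TD A B : T A -> T B -> mu (A `\` B) = Num.max 0 (mu A - mu B).
  by move=> TA TB; apply: (comparable_chargeD Fmu); [exact: TF..|exact: Tch].
have TN A B : T A -> T B -> null_sets F mu (A `\` B) <-> mu A <= mu B.
  move=> TA TB; rewrite (null_sets_charge0 Fmu); last first.
    exact: set_fieldD (TF _ TA) (TF _ TB).
  rewrite (TD _ _ TA TB) -subr_le0; split=> [<-|]; last exact: max_l.
  by rewrite le_max lexx orbT.
(* The approximating sequence needs a member of [T]; for empty [T] any map serves. *)
have [T0|nT0] := pselect (T !=set0); last first.
  exists id; split=> [A TA|A TA|A B TA]; by case: nT0; exists A.
have [a aT aP] := two_sided_dense_sequence mu T0.
pose r i j := mu (a i) <= mu (a j); pose b i := c (a i).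
have bB i : pj_completion F' mu (b i) by case: (cP _ (aT i)).
have bN i : null_sets F mu (b i `+` a i) by case: (cP _ (aT i)).
have EN n : null_sets F mu (disorder r b n).
  (* For [r i j], the difference of [a i] and [a j] is null by [TN], and passing to [b] costs two
     more null sets. *)
  apply: disorder_closed => // i j /(TN _ _ (aT i) (aT j)) nij.
  apply: null_sets_sub (NU _ _ nij (NU _ _ (bN i) (bN j))) => // x /=.
  by case: (pselect (a i x)); case: (pselect (a j x)); tauto.
(* At [A = a n] the index condition is [r^~ n] by unfolding, so the results on [rectified] apply. *)
pose phi A := rectified r b (fun i => mu (a i) <= mu A).
have phi_le A B : mu A <= mu B -> phi A `<=` phi B.
  by move=> AB x [i iA bx]; exists i => //; exact: le_trans AB.
have phiaB n : pj_completion F' mu (phi (a n)).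
  by apply: (@rectified_field _ r b) => //; exact: lexx.
have phiaN n : null_sets F mu (phi (a n) `+` a n).
  apply: null_sets_sub (NU _ _ (EN n) (bN n)) => // x.
  have := @rectified_sub _ r b n (lexx _) x; rewrite -/(phi (a n)) /=.
  by case: (pselect (b n x)); tauto.
have phia0 n : mu (phi (a n) `+` a n) = 0.
  by apply/(null_sets_charge0 Fmu (NF _ (phiaN n))).
have phiB A : T A -> pj_completion F' mu (phi A).
  (* By idempotence the bounds may come from the completion itself: [phi (a m)] and [phi (a n)],
     whose gap exceeds that of [a m] and [a n] only by null sets. *)
  move=> TA; apply: (pj_completion_idem Fmu F'f F'F BF) => eps eps0.
  have [|m [n [m1 m2 n1 n2]]] := aP A (eps / 2) TA; first by lra.
  exists (phi (a m)), (phi (a n)); split=> //; [exact: phi_le..|].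
  have Fnm := set_fieldD Ff (TF _ (aT n)) (TF _ (aT m)).
  have FD := set_fieldD Ff (BF _ (phiaB n)) (BF _ (phiaB m)).
  have FN := FU _ _ (NF _ (phiaN m)) (NF _ (phiaN n)).
  have munm : mu (a n `\` a m) < eps by rewrite TD // gt_max; lra.
  have := field_chargeU_le Fmu Fnm FN.
  have := field_chargeU_le Fmu (NF _ (phiaN m)) (NF _ (phiaN n)).
  suff /(field_charge_le Fmu FD (FU _ _ Fnm FN)) : phi (a n) `\` phi (a m) `<=`
    (a n `\` a m) `|` ((phi (a m) `+` a m) `|` (phi (a n) `+` a n)).
    by have := phia0 m; have := phia0 n; lra.
  by move=> x /=; case: (pselect (a m x)); case: (pselect (a n x)); tauto.
have phiN A : T A -> null_sets F mu (phi A `+` A).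
  move=> TA; apply/(null_setsP _ Fmu) => eps eps0.
  have [|m [n [m1 m2 n1 n2]]] := aP A (eps / 2) TA; first by lra.
  have FAm := set_fieldD Ff (TF _ TA) (TF _ (aT m)).
  have FnA := set_fieldD Ff (TF _ (aT n)) (TF _ TA).
  have FD := FU _ _ FAm FnA.
  have FN := FU _ _ (NF _ (phiaN m)) (NF _ (phiaN n)).
  (* A point of [phi A] outside [A] is in [phi (a n)], so in [a n] up to a null set; a point of [A]
     outside [phi A] is outside [phi (a m)], so outside [a m] up to a null set. *)
  exists ((A `\` a m `|` (a n `\` A)) `|`
    ((phi (a m) `+` a m) `|` (phi (a n) `+` a n))); split; first exact: FU.
    move=> x; have := @phi_le _ _ m2 x; have := @phi_le _ _ n1 x => /=.
    by case: (pselect (a m x)); case: (pselect (a n x)); tauto.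
  have muAm : mu (A `\` a m) < eps / 2 by rewrite TD // gt_max; lra.
  have munA : mu (a n `\` A) < eps / 2 by rewrite TD // gt_max; lra.
  have := field_chargeU_le Fmu FAm FnA; have := field_chargeU_le Fmu FD FN.
  have := field_chargeU_le Fmu (NF _ (phiaN m)) (NF _ (phiaN n)).
  by have := phia0 m; have := phia0 n; lra.
have phi_leP A B : T A -> T B -> mu A <= mu B <-> phi A `<=` phi B.
  (* Conversely, inclusion of the images covers the difference of [A] and [B] by two null sets, and
     [TN] turns this into a comparison of charges. *)
  move=> TA TB; split=> [/phi_le//|AB]; apply/(TN _ _ TA TB).
  apply: null_sets_sub (NU _ _ (phiN _ TA) (phiN _ TB)) => // x /=.
  by move: (AB x); case: (pselect (phi A x)); tauto.
have classE A B : T A -> T B ->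
    null_class F mu A = null_class F mu B <-> phi A = phi B.
  move=> TA TB; rewrite null_class_eqP//; [|exact: TF..].
  split=> [nAB|phiAB].
    apply/seteqP; split; apply/phi_leP => //; apply/TN => //;
      by apply: null_sets_sub nAB => // x; by [left|right].
  apply: null_sets_sub (NU _ _ (phiN _ TA) (phiN _ TB)) => // x /=.
  by rewrite phiAB; case: (pselect (phi B x)); tauto.
exists phi; split=> // A B TA TB; split; first exact: classE.
rewrite /null_class_lt null_class_leP//; [|exact: TF..].
rewrite (TN _ _ TA TB) (phi_leP _ _ TA TB) (classE _ _ TA TB).
by rewrite properEneq; split=> -[? ?]; split=> //; exact/eqP.
Qed.
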